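(* Let $d\ge2$. For every $\epsilon>0$ there is $\mathcal{H}_0=\mathcal{H}_0(d,\epsilon)\in\mathbb{R}$ such that for all $\mathcal{H}\ge\mathcal{H}_0$, \[ \frac{|\{\alpha\in\mathbb{C}: [\mathbb{Q}(\alpha):\mathbb{Q}]=d,\ H(\alpha)\le\mathcal{H}\}|}{|\{H(\alpha): \alpha\in\mathbb{C},\ [\mathbb{Q}(\alpha):\mathbb{Q}]=d,\ H(\alpha)\le\mathcal{H}\}|}\le\mathcal{H}^{\epsilon}. \]
   Context: $H$ is the absolute multiplicative Weil height: for $\alpha$ of degree $d$ with $a_0>0$ the leading coefficient of a minimal polynomial of $\alpha$ in $\mathbb{Z}[t]$ and conjugates $\alpha_1,\dots,\alpha_d$, $H(\alpha)=\big(a_0\prod_i\max\{1,|\alpha_i|\}\big)^{1/d}$. *)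

(* Defs.v *)
From mathcomp Require Import all_boot all_order all_algebra.
From mathcomp Require Import reals exp.
From mathcomp Require Export complex.
Set Implicit Arguments. Unset Strict Implicit. Unset Printing Implicit Defensive.
Import Order.TTheory GRing.Theory Num.Theory.
Local Open Scope ring_scope.

Section WeilHeight.
Variable R : realType.

(* [Q(x):Q] = d : x is a root of an irreducible rational polynomial of degree d
   (necessarily an associate of its minimal polynomial over Q). *)
Definition alg_degree (x : R[i]) (d : nat) : Prop :=
  exists p : {poly rat},
    irreducible_poly p /\ root (map_poly ratr p) x /\ (size p).-1 = d.

(* f is "the" minimal polynomial of x in Z[t] with positive leading coefficient:
   primitive (content 1, and zcontents carries the sign of the leading
   coefficient, so lead_coef f > 0), irreducible over Q, and vanishing at x. *)
Definition int_minpoly (x : R[i]) (f : {poly int}) : Prop :=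
  [/\ zcontents f = 1,
      irreducible_poly (map_poly intr f : {poly rat})
    & root (map_poly intr f : {poly R[i]}) x].

(* The complex roots (with multiplicity) of f, i.e. the conjugates. *)
Definition conjugates (f : {poly int}) : seq R[i] :=
  projT1 (closed_field_poly_normal (map_poly intr f : {poly R[i]})).

Definition mahler (f : {poly int}) : R :=
  (lead_coef f)%:~R *
  \prod_(r <- conjugates f) Num.max 1 (ComplexField.Normc.normc r).

Definition weil_height (x : R[i]) (h : R) : Prop :=
  exists f : {poly int},
    int_minpoly x f /\ h = powR (mahler f) ((size f).-1%:R)^-1.

End WeilHeight.

(* Main.v *)
(* If all but one conjugate of alpha lie in the open unit disc, f = a_d x^d + ... + a_0
   is its minimal polynomial and alpha < -1, then the Mahler measure is M = -a_d alpha.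
   Thus -M / a_d is a root of f, and M together with a_d determines f; moreover
   a_0 a_d^(d-1) depends on M only, so a_d is one of its divisors and at most X^o(1)
   polynomials share the same M.  Perron's criterion (a_{d-1} dominates the other
   coefficients) yields a box of such polynomials with the same order of magnitude,
   X^(d(d+1)), as the set of all numbers of degree d and height at most X: congruences
   modulo 4 make them Eisenstein at 2, and a positive proportion is primitive. *)
Require Import Defs.
From mathcomp Require Import all_boot all_order all_algebra.
From mathcomp Require Import boolp reals exp complex.
From mathcomp Require Import zify ring lra.
Set Implicit Arguments. Unset Strict Implicit. Unset Printing Implicit Defensive.
Import Order.TTheory GRing.Theory Num.Theory.

(** * Divisor bound and counting *)

(** Since [a + 1 <= k * (a %/ k + 1)] and [q + 1 <= 2 ^ q]. This pays for a small prime in the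
    divisor bound: [p ^ a] has [a + 1] divisors and [2 ^ a <= p ^ a]. *)
Lemma succ_expn_le k a : (0 < k)%N -> (a.+1 ^ k <= k ^ k * 2 ^ a)%N.
Proof.
move=> k0; apply: (@leq_trans ((k * (a %/ k).+1) ^ k)).
  by rewrite leq_exp2r // {1}(divn_eq a k) mulnS addnC mulnC ltn_add2r ltn_mod.
rewrite expnMn leq_mul2l; apply/orP; right.
apply: (@leq_trans ((2 ^ (a %/ k)) ^ k)); first by rewrite leq_exp2r // ltn_expl.
by rewrite -expnM leq_exp2l // leq_divM.
Qed.

Lemma size_divisors_pfactor p a m : prime p -> coprime p m -> (0 < m)%N ->
  (size (divisors (m * p ^ a)) <= a.+1 * size (divisors m))%N.
Proof.
move=> pp pm m0; have p0 := prime_gt0 pp.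
have -> : (a.+1 * size (divisors m) = size [seq e * p ^ i | i <- iota 0 a.+1, e <- divisors m])%N.
  by rewrite size_allpairs size_iota.
apply: uniq_leq_size; first exact: divisors_uniq.
move=> e; rewrite -dvdn_divisors ?muln_gt0 ?m0 ?expn_gt0 ?p0 // => ediv.
have n0 : (0 < m * p ^ a)%N by rewrite muln_gt0 m0 expn_gt0 p0.
have [e' pe' ee'] := pfactor_coprime pp (dvdn_gt0 n0 ediv).
apply/allpairsP; exists (logn p e, e'); split => //.
- rewrite mem_iota [fst _]/=.
  have := dvdn_leq_log p n0 ediv; rewrite lognM ?expn_gt0 ?p0 // pfactorK //.
  by rewrite (logn_coprime pm).
- rewrite [snd _]/= -dvdn_divisors // -(@Gauss_dvdl _ _ (p ^ a)); last first.
    by rewrite coprimeXr // coprime_sym.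
  by apply: dvdn_trans ediv; rewrite ee' dvdn_mulr.
Qed.

(** The number of divisors is [O(n^(1/k))], with the root cleared. Splitting off [p ^ a] multiplies
    it by at most [a + 1]. For [p >= 2 ^ k] the factor [(a + 1) ^ k] is absorbed by [p ^ a]; each of
    the at most [2 ^ k] smaller primes costs an extra [k ^ k]. *)
Lemma size_divisors_bound k n : (0 < k)%N -> (0 < n)%N ->
  (size (divisors n) ^ k <= (k ^ k) ^ (2 ^ k) * n)%N.
Proof.
move=> k0 n0; have kk0 : (0 < k ^ k)%N by rewrite expn_gt0 k0.
(* The induction needs the exact number of prime factors below [2 ^ k], which drops when such a
   prime is removed. *)
apply: (@leq_trans ((k ^ k) ^ count (fun p => p < 2 ^ k)%N (primes n) * n)%N); last first.
  rewrite leq_mul2r; apply/orP; right; rewrite leq_pexp2l // -size_filter.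
  rewrite -[leqRHS](size_iota 0); apply: uniq_leq_size.
    by rewrite filter_uniq // primes_uniq.
  by move=> p; rewrite mem_filter mem_iota => /andP[].
elim/ltn_ind: n n0 => n IH n0.
have [n1|n1] := leqP n 1.
  have -> : n = 1 by lia.
  by rewrite (_ : size (divisors 1) = 1)%N // exp1n.
pose p := pdiv n; have pp : prime p := pdiv_prime n1.
have p0 := prime_gt0 pp.
have [m pm nE] := pfactor_coprime pp n0.
set a := logn p n in nE.
have a0 : (0 < a)%N by rewrite logn_gt0 pi_pdiv.
have m0 : (0 < m)%N by move: n0; rewrite nE; case: (m).
have pa1 : (1 < p ^ a)%N by rewrite -(exp1n a) ltn_exp2r // prime_gt1.
have mn : (m < n)%N by rewrite nE ltn_Pmulr.
have pern : perm_eq (primes n) (p :: primes m).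
  apply: uniq_perm; rewrite /= ?primes_uniq ?andbT //.
    by rewrite mem_primes pp m0 /= -prime_coprime.
  move=> q; rewrite nE primesM ?expn_gt0 ?p0 // primesX // (primes_prime pp).
  by rewrite !inE orbC.
rewrite (permP pern) /= expnD {2}nE.
apply: (@leq_trans ((a.+1 * size (divisors m)) ^ k)).
  by rewrite leq_exp2r // {1}nE size_divisors_pfactor.
rewrite expnMn.
have -> : forall x y : nat, (x * y * (m * p ^ a) = (x * p ^ a) * (y * m))%N by move=> *; ring.
apply: leq_mul (IH _ mn m0).
have [pk|pk] := ltnP p (2 ^ k).
  rewrite expn1; apply: leq_trans (succ_expn_le a k0) _.
  by rewrite leq_mul2l leq_exp2r // prime_gt1 // orbT.
rewrite expn0 mul1n; apply: (@leq_trans ((2 ^ k) ^ a)); last by rewrite leq_exp2r.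
by rewrite -expnM mulnC expnM leq_exp2r // ltn_expl.
Qed.

(** [B] is the largest divisor count up to [M]; bounding its [k]-th power keeps everything in the
    natural numbers. *)
Lemma size_divisors_uniform k M : (0 < k)%N -> exists2 B,
  (B ^ k <= (k ^ k) ^ (2 ^ k) * M)%N &
  forall n, (0 < n <= M)%N -> (size (divisors n) <= B)%N.
Proof.
move=> k0; elim: M => [|M [B BM IH]].
  by exists 0%N; [rewrite exp0n | case].
exists (maxn B (size (divisors M.+1))).
  rewrite /maxn; case: ifP => _; first exact: size_divisors_bound.
  by apply: leq_trans BM _; rewrite leq_mul2l leqnSn orbT.
move=> n /andP[n0]; rewrite leq_eqVlt => /orP[/eqP->|nM].
  by rewrite leq_maxr.
by rewrite (leq_trans (IH n _)) ?leq_maxl // n0.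
Qed.

(** As [u] is invertible modulo [c], the solutions lie in one residue class, on which the quotient
    by [c] is injective. *)
Lemma card_dvdn_affine n c u v : (0 < c)%N -> coprime c u ->
  (#|[pred y : 'I_n | c %| u * y + v]| <= (n %/ c).+1)%N.
Proof.
move=> c0 cu; rewrite -[leqRHS]card_ord.
have h (y : 'I_n) : (y %/ c < (n %/ c).+1)%N by rewrite ltnS leq_div2r // ltnW.
apply: (@leq_card_in _ _ (fun y => Ordinal (h y))).
move=> y y'; rewrite !inE => hy hy' /(congr1 val) /= e; apply: val_inj => /=.
rewrite (divn_eq y c) (divn_eq y' c) e; congr (_ + _)%N; apply/eqP.
rewrite -[_ == _]/(y == y' %[mod c]).
wlog: y y' hy hy' {e} / (y <= y')%N => [H|le].
  by case/orP: (leq_total y y') => le; [apply: H | rewrite eq_sym; apply: H].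
rewrite eq_sym eqn_mod_dvd // -(@Gauss_dvdr _ u) // mulnBr.
by rewrite -(subnDr v) dvdn_sub.
Qed.

Lemma leq_count_fibers (T S : eqType) (F : T -> S) (s : seq T) B :
  (forall y, (count (fun x => F x == y) s <= B)%N) ->
  (size s <= B * size (undup (map F s)))%N.
Proof.
move=> H; set u := undup _.
have -> : size s = (\sum_(y <- u) count (fun x => F x == y) s)%N.
  rewrite (eq_bigr (fun y => \sum_(x <- s) (F x == y))%N); last first.
    by move=> y _; rewrite -sum1_count big_mkcond.
  rewrite exchange_big /= -sum1_size big_seq [RHS]big_seq; apply: eq_bigr => x xs.
  rewrite (eq_bigr (fun y => if y == F x then 1 else 0)%N); last first.
    by move=> y _; rewrite eq_sym; case: eqP.
  by rewrite -big_mkcond /= sum1_count count_uniq_mem ?undup_uniq // mem_undup map_f.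
apply: (@leq_trans (\sum_(y <- u) B)%N); first exact: leq_sum.
by rewrite big_const_seq count_predT iter_addn_0.
Qed.

(** * Primitive points of the box *)

(* Coefficient of x^i in a polynomial of the box: the shift by [2 (d+1) n] makes the
   second coefficient dominant, the parities give Eisenstein's criterion at 2. *)
Definition box_coef (d n i k : nat) : nat :=
  if i == d then 2 * k + 1 else
  if i == d.-1 then 2 * k + 2 * d.+1 * n else
  if i == 0 then 4 * k + 2 else 2 * k + 2.

(* The three coefficients already coprime for a positive proportion of the box. *)
Definition pivot (d i : nat) : bool := [|| i == d, i == d.-1 | i == 0].

Definition box (d n : nat) : predArgType := {ffun 'I_d.+1 -> 'I_n}.

Definition box_dvd (d n c : nat) (k : box d n) : bool :=
  [forall i : 'I_d.+1, pivot d i ==> (c %| box_coef d n i (k i))].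

(* Any common divisor of the coefficients is odd and divides the leading coefficient,
   which is smaller than [2 n]. *)
Definition box_prim (d n : nat) : {set box d n} :=
  [set k | [forall c : 'I_(2 * n).+1, odd c ==> (2 < c) ==> ~~ box_dvd c k]].

Lemma card_box d n : #|box d n| = (n ^ d.+1)%N.
Proof. by rewrite card_ffun !card_ord. Qed.

Lemma card_dvdn_affine2 n c u v : (0 < c <= 2 * n)%N -> coprime c u ->
  (c * #|[pred y : 'I_n | c %| u * y + v]| <= 2 * n)%N.
Proof.
move=> /andP[c0 c2n] cu.
apply: (@leq_trans (c * (n %/ c).+1)).
  by rewrite leq_mul2l card_dvdn_affine ?orbT.
rewrite mulnS mulnC; have [cn|nc] := leqP c n.
  by have := leq_divM n c; lia.
by rewrite divn_small // mul0n addn0.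
Qed.

(** The coordinates are independent. Each of the three pivot conditions holds for a proportion at
    most [2 / c], because [c] is odd and hence prime to the slopes 2 and 4; the other coordinates
    are left free. *)
Lemma card_box_dvd d n c : (1 < d)%N -> odd c -> (c <= 2 * n)%N ->
  (c ^ 3 * #|[pred k : box d n | box_dvd c k]| <= 8 * n ^ d.+1)%N.
Proof.
move=> d2 oc cn; have c0 : (0 < c)%N by case: (c) oc.
have c2 : coprime c 2 by rewrite coprimen2.
have c4 : coprime c 4 by rewrite -[4]/(2 ^ 2)%N coprimeXr.
pose F (i : 'I_d.+1) : pred 'I_n := fun y => pivot d i ==> (c %| box_coef d n i y).
have -> : #|[pred k : box d n | box_dvd c k]| = (\prod_i #|F i|)%N.
  transitivity #|family F|; last by rewrite card_family foldrE big_map -big_enum.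
  by apply: eq_card => k; apply/forallP/familyP => h i; exact: h i.
have prodE (a : nat) : (\prod_(i : 'I_d.+1) (if pivot d i then a else 1) = a ^ 3)%N.
  rewrite -big_mkcond prod_nat_const; congr (_ ^ _)%N.
  have -> : #|(fun i : 'I_d.+1 => pivot d i)| =
      #|(inord d : 'I_d.+1) |: (inord d.-1 |: [set ord0])|.
    apply: eq_card => i; rewrite !inE /in_mem /= /pivot -!val_eqE /= !inordK ?orbA //.
    by rewrite prednK // ltnW.
  rewrite !cardsU1 cards1 !inE -!val_eqE /= !inordK ?prednK //; last by lia.
  by have [-> [-> ->]] : (d == d.-1) = false /\ (d == 0) = false /\ (d.-1 == 0) = false by lia.
rewrite -(prodE c) -big_split /= -[8%N]/(2 ^ 3)%N -(prodE 2).
have -> : (n ^ d.+1 = \prod_(i : 'I_d.+1) n)%N by rewrite prod_nat_const card_ord.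
rewrite -big_split /=; apply: leq_prod => i _.
case: ifP => pi; last first.
  by rewrite !mul1n -[leqRHS]card_ord max_card.
rewrite (eq_card (B := [pred y : 'I_n | c %| box_coef d n i y])); last first.
  by move=> y; rewrite !inE /F pi.
move: pi; rewrite /pivot /box_coef.
case: eqP => _; first by rewrite card_dvdn_affine2 // c0.
case: eqP => _; first by rewrite card_dvdn_affine2 // c0.
by case: eqP => // _ _; rewrite card_dvdn_affine2 // c0.
Qed.

(* [8 / c^3 <= 4 / ((c-1) c) - 4 / (c (c+1))], which telescopes. *)
Lemma sum_cube_bound (N : nat -> nat) (V M : nat) :
  (forall j, (j < M)%N -> (j.+3 ^ 3 * N j <= 8 * V)%N) ->
  (3 * \sum_(j < M) N j <= 2 * V)%N.
Proof.
move=> H.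
(* The closed form of the telescoped sum from [c = 3] to [M + 2]; its limit [4 / 6] is the constant
   [2 / 3]. *)
suff: ((\sum_(j < M) N j)%:R <= (4 * V)%:R * (6^-1 - (M.+2 * M.+3)%:R^-1) :> rat)%R.
  set w := ((M.+2 * M.+3)%:R^-1)%R => h; rewrite -(ler_nat rat) natrM.
  have : (0 <= (4 * V)%:R * w)%R by rewrite mulr_ge0 ?invr_ge0.
  rewrite !natrM in h *; move: h; rewrite mulrBr; lra.
elim: M H => [|M IH] H.
  by rewrite big_ord0 [leRHS](_ : _ = 0)%R //; field.
rewrite big_ord_recr /= natrD.
have {}IH := IH (fun j jM => H j (ltnW jM)).
have := H M (ltnSn M); rewrite -(ler_nat rat) => h.
have m0 : (0 < M.+3%:R :> rat)%R by rewrite ltr0n.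
have hN : ((N M)%:R <= (8 * V)%:R * (M.+3%:R ^+ 3)^-1 :> rat)%R.
  by rewrite ler_pdivlMr ?exprn_gt0 // mulrC -natrX -natrM.
have hc : ((8 * V)%:R * (M.+3%:R ^+ 3)^-1 <=
   (4 * V)%:R * ((M.+2 * M.+3)%:R^-1 - (M.+3 * M.+4)%:R^-1) :> rat)%R.
  rewrite (_ : 8 * V = 4 * V * 2)%N; last by lia.
  rewrite [in leLHS]natrM -mulrA ler_wpM2l //.
  rewrite -(ler_pM2r (exprn_gt0 3 m0)) mulfVK ?lt0r_neq0 ?exprn_gt0 //.
  have m20 : (0 < M.+2%:R :> rat)%R by rewrite ltr0n.
  have m40 : (0 < M.+4%:R :> rat)%R by rewrite ltr0n.
  rewrite !natrM -(ler_pM2r (mulr_gt0 m20 m40)).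
  have E (x y z : rat) : (x != 0 -> y != 0 -> z != 0 ->
    ((x * y)^-1 - (y * z)^-1) * y ^+ 3 * (x * z) = y ^+ 2 * (z - x))%R.
    by move=> x0 y0 z0; field; rewrite ?x0 ?y0 ?z0.
  rewrite E ?lt0r_neq0 //.
  have -> : (M.+4%:R = M.+3%:R + 1 :> rat)%R by rewrite natr1.
  have -> : (M.+2%:R = M.+3%:R - 1 :> rat)%R by rewrite -(natr1 M.+2) addrK.
  by nra.
rewrite mulrBr in IH; rewrite mulrBr in hc; rewrite mulrBr.
move: IH hN hc; move: (_ / _)%R (_ / _)%R (_ / _)%R (_ / _)%R.
by move=> *; lra.
Qed.

(** A union bound over all odd divisors [c >= 3] already suffices: the excluded proportion is at
    most [2 / 3]. *)
Lemma card_box_prim d n : (1 < d)%N -> (n ^ d.+1 <= 3 * #|box_prim d n|)%N.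
Proof.
move=> d2.
suff: (3 * #|~: box_prim d n| <= 2 * n ^ d.+1)%N.
  by have := cardsC (box_prim d n); rewrite card_box; lia.
(* The index [j] stands for the divisor [c = j + 3], so [j < 2n - 2] covers 3 to [2n]; even [c]
   contribute nothing. *)
pose N j := if odd j.+3 then #|[pred k : box d n | box_dvd j.+3 k]| else 0%N.
apply: leq_trans (sum_cube_bound (N := N) (V := n ^ d.+1) (M := (2 * n - 2)%N) _); last first.
  move=> j jM; rewrite /N; case: ifP => oj; last by rewrite muln0.
  by apply: card_box_dvd => //; lia.
rewrite leq_mul2l /=.
apply: (@leq_trans (\sum_(j < 2 * n - 2) \sum_(k : box d n) (odd j.+3 && box_dvd j.+3 k))%N).
  rewrite exchange_big -sum1_card /= big_mkcond; apply: leq_sum => k _.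
  case: ifP => //; rewrite !inE negb_forall => /existsP[c].
  rewrite !negb_imply => /and4P[oc c2 h _].
  have cM : (c - 3 < 2 * n - 2)%N by have := ltn_ord c; lia.
  rewrite (bigD1 (Ordinal cM)) //=.
  have E : (c - 3).+3 = c by lia.
  by rewrite -[~~ ~~ ~~ _]/(odd (c - 3).+3) E oc h.
apply: leq_sum => j _; rewrite /N; case: (odd _) => /=; last by rewrite big1.
by rewrite -sum1_card [leqRHS]big_mkcond; apply: leq_sum => k _; rewrite inE; case: box_dvd.
Qed.

Local Open Scope ring_scope.

(** * Polynomials with one root outside the unit disc *)

Lemma coef_XsubCM (C : comNzRingType) (a : C) (q : {poly C}) j :
  (('X - a%:P) * q)`_j = (if j is j'.+1 then q`_j' else 0) - a * q`_j.
Proof. by rewrite mulrBl coefB coefXM coefCM; case: j. Qed.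

(* Perron: a dominant second coefficient of [(X - a) q] with [|a| > 1] makes
   the leading coefficient of [q] dominant, so that [q] has its roots in the
   open unit disc. *)
Lemma dominant_cofactor (C : numDomainType) (a : C) (q : {poly C}) n
    (f := ('X - a%:P) * q) : 1 < `|a| ->
  `|q`_n.+1| + \sum_(j < n.+1) `|f`_j| < `|f`_n.+1| ->
  \sum_(j < n.+1) `|q`_j| < `|q`_n.+1|.
Proof.
move=> a1 H; pose S' := \sum_(j < n) `|q`_j|.
have SE : \sum_(j < n.+1) `|q`_j| = S' + `|q`_n| by rewrite big_ord_recr.
have h1 : `|a| * (S' + `|q`_n|) - S' <= \sum_(j < n.+1) `|f`_j|.
  rewrite -SE mulr_sumr /S' [X in X - _]big_ord_recl [leRHS]big_ord_recl -addrA -sumrB.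
  apply: lerD; first by rewrite /f coef_XsubCM sub0r normrN normrM.
  apply: ler_sum => j _; rewrite /f coef_XsubCM /= /bump /= add1n -normrM distrC.
  exact: lerB_dist.
have h2 : `|f`_n.+1| <= `|q`_n| + `|a| * `|q`_n.+1|.
  by rewrite /f coef_XsubCM -normrM; exact: ler_normB.
have h3 := lt_le_trans (le_lt_trans (lerD (lexx _) h1) H) h2.
rewrite SE -subr_gt0 -(pmulr_rgt0 _ (_ : 0 < `|a| - 1)) ?subr_gt0 //.
rewrite -subr_gt0 in h3; congr (0 < _): h3; ring.
Qed.

(** For [|z| >= 1] every lower power of [z] is at most [|z| ^ (n + 1)] in modulus, so the lower
    terms cannot cancel the leading one. *)
Lemma root_dominant_lead (C : numDomainType) (q : {poly C}) n z :
  (size q <= n.+2)%N -> \sum_(j < n.+1) `|q`_j| < `|q`_n.+1| -> root q z -> `|z| < 1.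
Proof.
move=> sq H /rootP; rewrite (horner_coef_wide _ sq) big_ord_recr /=.
rewrite real_ltNge ?normr_real // => /eqP; rewrite addr_eq0 => /eqP e.
apply/negP => z1; have z0 : 0 < `|z| by apply: lt_le_trans z1.
suff : `|q`_n.+1| * `|z| ^+ n.+1 < `|q`_n.+1| * `|z| ^+ n.+1 by rewrite ltxx.
rewrite -[X in X < _](_ : `|- (q`_n.+1 * z ^+ n.+1)| = _); last first.
  by rewrite normrN normrM normrX.
rewrite -e.
apply: (@le_lt_trans _ _ (\sum_(j < n.+1) `|q`_j| * `|z| ^+ n.+1)).
  apply: le_trans (ler_norm_sum _ _ _) _; apply: ler_sum => j _.
  by rewrite normrM normrX ler_wpM2l // ler_weXn2l // ltnW.
by rewrite -mulr_suml ltr_pM2r // exprn_gt0.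
Qed.

(** The gcd commutes with field extension and vanishes at [x], so it is not constant and must be
    associate to [p]. *)
Lemma irreducible_common_root (F L : fieldType) (phi : {rmorphism F -> L})
    (p q : {poly F}) (x : L) : irreducible_poly p -> q != 0 ->
  root (map_poly phi p) x -> root (map_poly phi q) x -> p %| q.
Proof.
move=> [_ irr] q0 px qx; have := dvdp_gcdr p q; apply: dvdp_trans.
have g0 : gcdp p q != 0 by rewrite gcdp_eq0 (negPf q0) andbF.
suff s1 : size (gcdp p q) != 1 by have := irr _ s1 (dvdp_gcdl p q); rewrite eqp_sym => /eqp_dvdl ->.
apply/negP => /size_poly1P[c c0 e].
have : root (map_poly phi (gcdp p q)) x by rewrite gcdp_map root_gcd px qx.
by rewrite e map_polyC rootC fmorph_eq0 (negPf c0).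
Qed.

(** [q(aX)] vanishes at [x] and has the same degree as the irreducible [p], so the two are
    proportional. This will compare two box polynomials whose real roots differ by a rational
    factor. *)
Lemma irreducible_scaled_root (F L : fieldType) (phi : {rmorphism F -> L})
    (p q : {poly F}) (a : F) (x : L) : irreducible_poly p -> size p = size q -> a != 0 ->
  root (map_poly phi p) x -> root (map_poly phi q) (phi a * x) ->
  exists c, forall i, p`_i = c * (q`_i * a ^+ i).
Proof.
move=> irr spq a0 px qx.
pose r := \poly_(i < size q) (q`_i * a ^+ i).
have p0 := irredp_neq0 irr.
have q0 : q != 0 by rewrite -size_poly_eq0 -spq size_poly_eq0.
have sr : size r = size q.
  rewrite size_poly_eq // mulf_neq0 ?expf_neq0 // -/(lead_coef q) lead_coef_eq0 //.
have rx : root (map_poly phi r) x.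
  move: qx; rewrite !rootE !horner_coef !size_map_poly sr => /eqP h; apply/eqP; rewrite -[RHS]h.
  apply: eq_bigr => i _; rewrite !coef_map coef_poly ltn_ord /=.
  by rewrite rmorphM rmorphXn /= exprMn mulrA.
have r0 : r != 0 by rewrite -size_poly_eq0 sr size_poly_eq0.
have /eqpf_eq [c c0 ->] : p %= r.
  by rewrite -dvdp_size_eqp ?sr ?spq // (irreducible_common_root irr r0 px rx).
exists c => i; rewrite coefZ coef_poly; case: ltnP => // h.
by rewrite nth_default ?mul0r // spq.
Qed.

(** * Mahler measures of integer polynomials *)

Section Mahler.
Variable R : realType.
Implicit Types (f : {poly int}) (x : R).
Local Notation normc := ComplexField.Normc.normc.
Local Notation toC f := (map_poly intr f : {poly R[i]}).

Lemma normr_normc (z : R[i]) : `|z| = (normc z)%:C%C.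
Proof. by []. Qed.

Lemma conjugatesE f : toC f = (lead_coef f)%:~R *: \prod_(r <- conjugates R f) ('X - r%:P).
Proof.
rewrite /conjugates; case: closed_field_poly_normal => r /= {1}->.
by rewrite lead_coef_map_inj //; exact: intr_inj.
Qed.

Lemma size_conjugates f : f != 0 -> (size (conjugates R f)).+1 = size f.
Proof.
move=> f0; have := congr1 (size \o polyseq) (conjugatesE f).
rewrite /= size_scale ?intr_eq0 ?lead_coef_eq0 // size_prod_XsubC => <-.
by rewrite size_map_inj_poly //; exact: intr_inj.
Qed.

Lemma root_conjugates f z : f != 0 -> root (toC f) z = (z \in conjugates R f).
Proof.
move=> f0; rewrite conjugatesE rootZ ?root_prod_XsubC //.
by rewrite intr_eq0 lead_coef_eq0.
Qed.

Lemma max1_normc (z : R[i]) : `|z| < 1 -> Num.max 1 (normc z) = 1.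
Proof.
rewrite normr_normc -[1 : R[i]]/(1%:C%C) ltcR => h.
by apply/max_idPl; exact: ltW.
Qed.

Lemma map_intr_toC f : toC f = map_poly (real_complex R) (map_poly intr f).
Proof. by rewrite -map_poly_comp; apply: eq_map_poly => a /=; rewrite rmorph_int. Qed.

(** The first inequality forces a root outside the closed unit disc, the second (Perron) puts all
    others inside the open disc. Uniqueness makes the large root real, positivity of the
    coefficients makes it negative, and it alone contributes to the Mahler measure. *)
Lemma mahler_dominant f n : size f = n.+3 ->
  (forall i, (i < n.+3)%N -> 0 < f`_i) ->
  n.+2%:R * f`_n.+2 < f`_n.+1 ->
  f`_n.+2 + \sum_(j < n.+1) f`_j < f`_n.+1 ->
  exists x : R, [/\ x < - 1, root (map_poly intr f) x & mahler R f = - ((f`_n.+2)%:~R * x)].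
Proof.
move=> sf fpos H1 H2.
have f0 : f != 0 by rewrite -size_poly_eq0 sf.
have lf : lead_coef f = f`_n.+2 by rewrite lead_coefE sf.
have lpos : (0 : R[i]) < (lead_coef f)%:~R by rewrite ltr0z lf fpos.
have cf i : (toC f)`_i = (f`_i)%:~R by rewrite coef_map.
have nf i : (i < n.+3)%N -> `|(toC f)`_i| = (f`_i)%:~R.
  by move=> h; rewrite cf gtr0_norm // ltr0z fpos.
set rs := conjugates R f.
have srs : size rs = n.+2 by have := size_conjugates f0; rewrite sf => -[].
(* Otherwise, by Vieta, the second coefficient would be at most [n + 2] times the leading one. *)
have [r rrs r1] : exists2 r, r \in rs & 1 < `|r|.
  apply/hasP/negPn/negP => /hasPn h.
  have := nf n.+1 (ltnW (ltnSn _)); rewrite conjugatesE coefZ -/rs.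
  have -> : n.+1 = (size rs).-1 by rewrite srs.
  rewrite coefPn_prod_XsubC ?srs // normrM normrN (gtr0_norm lpos) => e.
  have : (f`_n.+1)%:~R <= (lead_coef f)%:~R * n.+2%:R :> R[i].
    rewrite -e ler_pM2l // (le_trans (ler_norm_sum _ _ _)) //.
    rewrite -srs -sum1_size natr_sum big_seq [leRHS]big_seq; apply: ler_sum => i irs.
    by rewrite real_leNgt ?normr_real ?real1 // h.
  rewrite -[n.+2%:R]/(n.+2%:~R) -rmorphM /= ler_int lf => h'.
  by move: H1; rewrite ltNge mulrC natz h'.
have prs := perm_to_rem rrs; set rs' := rem r rs in prs.
pose q := (lead_coef f)%:~R *: \prod_(z <- rs') ('X - z%:P) : {poly R[i]}.
have fq : toC f = ('X - r%:P) * q.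
  by rewrite conjugatesE -/rs (perm_big _ prs) big_cons /q -scalerAr.
have lq : q`_n.+1 = (lead_coef f)%:~R.
  have sq : size rs' = n.+1 by rewrite size_rem // srs.
  rewrite coefZ; have /monicP := monic_prod_XsubC rs' xpredT id.
  by rewrite lead_coefE size_prod_XsubC sq /= => ->; rewrite mulr1.
have small z : z \in rs' -> `|z| < 1.
  move=> zrs; apply: (@root_dominant_lead _ q n).
  - rewrite size_scale ?gt_eqF // size_prod_XsubC size_rem // srs //.
  - apply: (dominant_cofactor r1); rewrite -fq lq gtr0_norm // nf //.
    rewrite (eq_bigr (fun j : 'I_n.+1 => (f`_j)%:~R)); last first.
      by move=> j _; have := ltn_ord j => ?; rewrite nf //; lia.
    by rewrite -rmorph_sum -rmorphD /= ltr_int lf.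
  - by rewrite rootZ ?gt_eqF // root_prod_XsubC.
(* The complex conjugate of [r] is a root of the same modulus, and every other root has modulus
   below 1. *)
have rreal : r^*%C = r.
  have : r^*%C \in rs.
    rewrite -root_conjugates // -complex_root_conj -map_poly_comp.
    rewrite (eq_map_poly (g := intr)) ?root_conjugates // => a /=.
    by rewrite rmorph_int.
  rewrite (perm_mem prs) inE => /orP[/eqP //|/small].
  by rewrite normcJ => /(lt_trans r1); rewrite ltxx.
have rE : r = (complex.Re r)%:C%C.
  case: r rreal {rrs r1 rs' prs q fq lq small} => a b /= [] /eqP.
  by rewrite -subr_eq0 -opprD oppr_eq0 -mulr2n mulrn_eq0 /= => /eqP ->.
set x := complex.Re r in rE.
have rx : root (map_poly intr f) x.
  have : root (toC f) r by rewrite root_conjugates.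
  by rewrite map_intr_toC rE fmorph_root.
have x0 : x < 0.
  rewrite ltNge; apply/negP => x0; have /rootP := rx.
  have sm : size (map_poly intr f : {poly R}) = n.+3.
    by rewrite size_map_inj_poly //; exact: intr_inj.
  rewrite horner_coef sm big_ord_recl coef_map expr0 mulr1 => e.
  have : 0 < (f`_0)%:~R :> R by rewrite ltr0z fpos.
  have : 0 <= \sum_(i < n.+2) (map_poly intr f)`_(bump 0 i) * x ^+ bump 0 i.
    apply: sumr_ge0 => i _; rewrite coef_map mulr_ge0 ?exprn_ge0 // ler0z ltW // fpos //.
    by rewrite /bump add1n ltnS.
  move: e => /=; lra.
have nr : normc r = - x.
  by rewrite rE /= expr0n /= addr0 sqrtr_sqr ltr0_norm.
have := r1; rewrite normr_normc nr -[1 : R[i]]/(1%:C%C) ltcR => h.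
exists x; split; rewrite 1?ltrNr //.
rewrite /mahler -/rs (perm_big _ prs) big_cons big_seq big1 => [|z zrs]; last first.
  by apply: max1_normc; exact: small.
by rewrite nr /= mulr1 lf (max_idPr (ltW h)) mulrN.
Qed.

(** With [y = - x > 1], the equation bounds the leading term [f_(n+2) y^(n+2)] by the lower terms,
    each at most [f_j y^(n+1)]; dividing by [y^(n+1)] concludes. It makes the measures in the box
    linear in [n]. *)
Lemma root_lead_le f n x : (forall i, (i < n.+3)%N -> 0 < f`_i) -> size f = n.+3 ->
  x < - 1 -> root (map_poly intr f) x ->
  - ((f`_n.+2)%:~R * x) <= \sum_(j < n.+2) (f`_j)%:~R :> R.
Proof.
move=> fpos sf x1 /rootP; rewrite -mulrN; set y := - x.
have y1 : 1 < y by rewrite ltrNr.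
have y0 : 0 < y by apply: lt_trans y1.
have sm : size (map_poly intr f : {poly R}) = n.+3.
  by rewrite size_map_inj_poly //; exact: intr_inj.
have xy : `|x| = y by rewrite ltr0_norm // -oppr_gt0.
rewrite horner_coef sm big_ord_recr /= => /eqP; rewrite addrC addr_eq0 => /eqP.
move/(congr1 (fun z => `|z|)); rewrite normrN coef_map normrM normrX xy.
rewrite gtr0_norm ?ltr0z ?fpos // => e.
rewrite -(ler_pM2r (exprn_gt0 n.+1 y0)) -mulrA -exprS e.
apply: le_trans (ler_norm_sum _ _ _) _; rewrite mulr_suml; apply: ler_sum => j _.
have j3 : (j < n.+3)%N by rewrite (ltn_trans (ltn_ord j)).
rewrite coef_map normrM normrX xy gtr0_norm ?ltr0z ?fpos //.
by rewrite ler_wpM2l ?ler0z ?(ltW (fpos _ j3)) // ler_weXn2l ?(ltW y1) // -ltnS.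
Qed.

(** A factor [X - r] multiplies a bound on all coefficients by at most
    [1 + |r| <= 2 max(1, |r|)]. *)
Lemma coef_prod_XsubC_le (rs : seq R[i]) i :
  `|(\prod_(r <- rs) ('X - r%:P))`_i| <= (2 ^+ size rs * \prod_(r <- rs) Num.max 1 (normc r))%:C%C.
Proof.
elim: rs i => [|r rs IH] i.
  rewrite !big_nil mulr1 coef1; case: eqP => _; rewrite ?normr1 ?normr0.
    by rewrite lexx.
  by rewrite -[0 : R[i]]/(0%:C%C) lecR ler01.
rewrite !big_cons coef_XsubCM.
apply: le_trans (ler_normB _ _) _; rewrite normrM.
set B := 2 ^+ size rs * _ in IH; set m := Num.max 1 _.
have m1 : 1 <= m by rewrite le_max lexx.
have mr : normc r <= m by rewrite le_max lexx orbT.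
have B0 : 0 <= B.
  by rewrite -lecR; apply: le_trans (IH 0%N); exact: normr_ge0.
rewrite exprS -mulrA [_ * (m * _)]mulrCA -/B -/B mulrA.
have -> : (2 * m * B)%:C%C = (m * B)%:C%C + (m * B)%:C%C.
  by rewrite -rmorphD /=; congr (_%:C%C); ring.
apply: lerD.
  apply: (@le_trans _ _ B%:C%C); last by rewrite lecR ler_peMl.
  by case: i => [|i]; [rewrite normr0 -[0 : R[i]]/(0%:C%C) lecR | exact: IH].
rewrite rmorphM /=; apply: ler_pM => //; by rewrite ?normr_normc ?lecR.
Qed.

Lemma coef_le_mahler f i : 0 < lead_coef f ->
  `|f`_i|%:~R <= 2 ^+ (size f).-1 * mahler R f.
Proof.
move=> lf; have f0 : f != 0 by rewrite -lead_coef_eq0 gt_eqF.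
have := coef_prod_XsubC_le (conjugates R f) i.
have -> : size (conjugates R f) = (size f).-1 by rewrite -size_conjugates.
move=> h; rewrite -lecR rmorph_int intr_norm -[(f`_i)%:~R]coef_map conjugatesE coefZ normrM.
rewrite gtr0_norm ?ltr0z // /mahler mulrCA rmorphM /= rmorph_int.
by rewrite ler_pM2l ?ltr0z.
Qed.

End Mahler.

(** * Polynomials of the box *)

Definition box_poly (d n : nat) (k : box d n) : {poly int} :=
  \poly_(i < d.+1) (box_coef d n i (k (inord i)))%:Z.

Section Box.
Variable R : realType.
Variables e n : nat.
Local Notation d := e.+2.
Implicit Types k : box d n.

Lemma coef_box_poly k i : (i < d.+1)%N ->
  (box_poly k)`_i = (box_coef d n i (k (inord i)))%:Z.
Proof. by move=> h; rewrite coef_poly h. Qed.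

Lemma box_coef_top a : box_coef d n d a = (2 * a + 1)%N.
Proof. by rewrite /box_coef eqxx. Qed.

Lemma box_coef_second a : box_coef d n e.+1 a = (2 * a + 2 * e.+3 * n)%N.
Proof. by rewrite /box_coef eqxx ltn_eqF. Qed.

Lemma box_coef_0 a : box_coef d n 0 a = (4 * a + 2)%N.
Proof. by []. Qed.

Lemma box_coef_mid i a : (0 < i < e.+1)%N -> box_coef d n i a = (2 * a + 2)%N.
Proof.
move=> /andP[i0 ie]; rewrite /box_coef /=.
have -> : (i == e.+2) = false by lia.
have -> : (i == e.+1) = false by lia.
by have -> : (i == 0%N) = false by lia.
Qed.

Lemma box_coef_gt0 i a : (0 < n)%N -> (0 < box_coef d n i a)%N.
Proof. by rewrite /box_coef => n0; do 3?case: ifP => _; lia. Qed.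

Lemma box_coef_inj i : injective (box_coef d n i).
Proof. by move=> a b; rewrite /box_coef; do 3?case: ifP => _; lia. Qed.

Lemma box_gt0 k : (0 < n)%N.
Proof. exact: leq_ltn_trans (leq0n _) (ltn_ord (k ord0)). Qed.

Lemma size_box_poly k : size (box_poly k) = d.+1.
Proof. by rewrite size_poly_eq // box_coef_top; lia. Qed.

Lemma lead_coef_box_poly k :
  lead_coef (box_poly k) = (2 * k (inord d) + 1)%N%:Z.
Proof. by rewrite lead_coefE size_box_poly coef_box_poly // box_coef_top. Qed.

Lemma box_poly_gt0 k i : (i < d.+1)%N -> 0 < (box_poly k)`_i.
Proof.
by move=> h; rewrite coef_box_poly // ltz_nat; apply: box_coef_gt0; exact: box_gt0 k.
Qed.

Lemma sum_low_coef k :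
  (\sum_(j < e.+1) box_coef d n j (k (inord j)) + 2 <= (2 * e + 4) * n)%N.
Proof.
rewrite big_ord_recl box_coef_0.
apply: (@leq_trans (4 * k (inord 0) + 2 + \sum_(j < e) (2 * n) + 2)%N).
  rewrite leq_add2r leq_add2l; apply: leq_sum => j _.
  have := ltn_ord j; rewrite /= /bump add1n => h.
  rewrite box_coef_mid //; have := ltn_ord (k (inord j.+1)); lia.
by rewrite sum_nat_const card_ord; have := ltn_ord (k (inord 0)); nia.
Qed.

Lemma sum_low_poly k : \sum_(j < e.+1) (box_poly k)`_j =
  (\sum_(j < e.+1) box_coef d n j (k (inord j)))%N%:Z.
Proof.
rewrite -natz natr_sum; apply: eq_bigr => j _.
by rewrite coef_box_poly ?natz // (ltn_trans (ltn_ord j)).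
Qed.

(** The shift [2(e+3)n] exceeds the leading coefficient plus the lower ones, as Perron's condition
    requires. The non-leading coefficients sum to at most [(2e+4)n + 2n + 2(e+3)n = 4(e+3)n], which
    bounds the measure. *)
Lemma mahler_box k : exists x : R, [/\ x < - 1, root (map_poly intr (box_poly k)) x,
  mahler R (box_poly k) = - ((2 * k (inord d) + 1)%N%:R * x)
  & mahler R (box_poly k) <= (4 * e.+3 * n)%N%:R].
Proof.
have top : (box_poly k)`_d = (2 * k (inord d) + 1)%N%:Z.
  by rewrite coef_box_poly // box_coef_top.
have sec : (box_poly k)`_e.+1 = (2 * k (inord e.+1) + 2 * e.+3 * n)%N%:Z.
  by rewrite coef_box_poly // box_coef_second.
have kd := ltn_ord (k (inord d)); have ke := ltn_ord (k (inord e.+1)).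
have low := sum_low_coef k.
have [] := @mahler_dominant R (box_poly k) e (size_box_poly k) (@box_poly_gt0 k).
- by rewrite top sec -natz -natrM !natz ltz_nat; nia.
- by rewrite top sec sum_low_poly -PoszD ltz_nat; nia.
move=> x [x1 rx mx]; exists x; split => //; first by rewrite mx top.
rewrite mx; apply: le_trans (root_lead_le (@box_poly_gt0 k) (size_box_poly k) x1 rx) _.
rewrite big_ord_recr /= sec -rmorph_sum /= sum_low_poly -rmorphD /= -PoszD.
rewrite -[leRHS]/((_%:Z)%:~R) ler_int lez_nat.
by move: low ke; move: (\sum_(j < _) _)%N (nat_of_ord _) => S a; nia.
Qed.

Lemma irreducible_box_poly k : irreducible_poly (map_poly intr (box_poly k) : {poly rat}).
Proof.
apply/irreducible_rat_int/(@eisenstein_crit 2) => //.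
- by rewrite size_box_poly.
- by rewrite lead_coef_box_poly dvdzE /=; lia.
- by rewrite coef_box_poly // box_coef_0 dvdzE /=; lia.
- move=> i; rewrite size_box_poly /= => h; rewrite coef_box_poly ?(ltn_trans h) // dvdzE /=.
  have : (i == d) = false by lia.
  by rewrite /box_coef => ->; do 2?case: ifP => _; lia.
Qed.

Lemma zcontents_box_poly k : k \in box_prim d n -> zcontents (box_poly k) = 1.
Proof.
rewrite inE => /forallP H.
have f0 : box_poly k != 0 by rewrite -size_poly_eq0 size_box_poly.
have spos : 0 < zcontents (box_poly k).
  by rewrite -sgz_gt0 sgz_contents sgz_gt0 lead_coef_box_poly ltz_nat addn1.
set c := `|zcontents (box_poly k)|%N.
have cE : zcontents (box_poly k) = c%:Z by rewrite gez0_abs // ltW.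
have cdvd i : (i < d.+1)%N -> (c %| box_coef d n i (k (inord i)))%N.
  move=> h; have : (c%:Z %| zcontents (box_poly k))%Z by rewrite cE.
  rewrite dvdz_contents => /polyOverP/(_ i).
  by rewrite coef_box_poly // => /dvdzP[q] /(congr1 absz); rewrite abszM /= => ->;
    rewrite dvdn_mull.
have ctop := cdvd d (ltnSn _); rewrite box_coef_top in ctop.
have oc : odd c by apply: dvdn_odd ctop _; lia.
have kd := ltn_ord (k (inord d)).
have cn : (c < (2 * n).+1)%N by have := dvdn_leq _ ctop; lia.
have := H (Ordinal cn); rewrite /= oc /=.
case: ltnP => [c2 /=|c2 _]; last by rewrite cE; move: oc c2; case: (c) => [|[|[|]]].
move/negP; case; apply/forallP => i; apply/implyP => _.
by have := cdvd i (ltn_ord i); rewrite inord_val.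
Qed.

(** Let [a], [b] be the leading coefficients and [x], [y] the large roots. Equal measures give
    [y = (a/b) x], hence [f_i = c g_i (a/b)^i] for the two polynomials [f], [g]. The case [i = d]
    yields [c (a/b)^(d-1) = 1], which eliminates [c]. *)
Lemma mahler_box_eq k k' : mahler R (box_poly k) = mahler R (box_poly k') ->
  forall i, (i < d)%N ->
  (box_coef d n i (k (inord i)) * (2 * k (inord d) + 1) ^ (e.+1 - i) =
   box_coef d n i (k' (inord i)) * (2 * k' (inord d) + 1) ^ (e.+1 - i))%N.
Proof.
have [x [_ rx -> _]] := mahler_box k; have [y [_ ry -> _]] := mahler_box k'.
move=> E i ide.
have toR (f : {poly int}) : map_poly intr f =
    map_poly ratr (map_poly intr f : {poly rat}) :> {poly R}.
  by rewrite -map_poly_comp; apply: eq_map_poly => a /=; rewrite ratr_int.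
set a := (2 * k (inord d) + 1)%N in E *; set b := (2 * k' (inord d) + 1)%N in E *.
have a0 : (a%:R : rat) != 0 by rewrite pnatr_eq0; lia.
have b0 : (b%:R : rat) != 0 by rewrite pnatr_eq0; lia.
have bR : (b%:R : R) != 0 by rewrite pnatr_eq0; lia.
have sQ k1 : size (map_poly intr (box_poly k1) : {poly rat}) = d.+1.
  by rewrite size_map_inj_poly ?size_box_poly //; exact: intr_inj.
have cQ k1 j : (j < d.+1)%N -> (map_poly intr (box_poly k1))`_j =
    (box_coef d n j (k1 (inord j)))%:R :> rat.
  by move=> h; rewrite coef_map coef_box_poly.
have [||||c H] := @irreducible_scaled_root _ R ratr _ (map_poly intr (box_poly k'))
   (a%:R / b%:R) x (irreducible_box_poly k).
- by rewrite !sQ.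
- by rewrite mulf_neq0 ?invr_eq0.
- by rewrite -toR.
- rewrite -toR rmorphM fmorphV /= !ratr_nat (_ : _ * x = y) //.
  by apply: (mulfI bR); rewrite mulrA [b%:R * _]mulrC mulfVK //; apply: oppr_inj.
have Hd := H d; rewrite !cQ // !box_coef_top -/a -/b in Hd.
have Hi := H i; rewrite !cQ ?(ltn_trans ide) // in Hi.
have c1 : c * (a%:R / b%:R) ^+ e.+1 = 1.
  apply: (mulfI a0); rewrite mulr1 [RHS]Hd [_ ^+ e.+2]exprS.
  by rewrite [b%:R * _]mulrA [b%:R * _]mulrC divfK // mulrCA.
apply/eqP; rewrite -(eqr_nat rat) !natrM !natrX Hi; apply/eqP.
have -> : (a%:R : rat) ^+ (e.+1 - i) = (a%:R / b%:R) ^+ (e.+1 - i) * b%:R ^+ (e.+1 - i).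
  by rewrite -exprMn divfK.
have {c1} : c * ((a%:R / b%:R) ^+ i * (a%:R / b%:R) ^+ (e.+1 - i)) = 1.
  by rewrite -exprD subnKC.
move: (_ ^+ i) (_ ^+ (e.+1 - i)) (b%:R ^+ (_ - _)) => u v w c1.
by rewrite -[RHS]mul1r -[X in _ = X * _]c1; ring.
Qed.

(** On a fibre, [a_0 a_d^(d-1)] is constant by the case [i = 0] of [mahler_box_eq], so [a_d] is one
    of its divisors; the other cases show that [a_d] determines the whole tuple. *)
Lemma count_mahler_box B y :
  (forall N, (0 < N <= (4 * n) ^ d)%N -> (size (divisors N) <= B)%N) ->
  (count (fun k => mahler R (box_poly k) == y) (enum (box_prim d n)) <= B)%N.
Proof.
move=> HB; rewrite -size_filter; set s := filter _ _.
have us : uniq s by rewrite filter_uniq // enum_uniq.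
have sy k : k \in s -> mahler R (box_poly k) = y.
  by rewrite mem_filter => /andP[/eqP].
case sE : s => [|k0 s'] //; rewrite -sE.
have k0s : k0 \in s by rewrite sE mem_head.
pose N k := (box_coef d n 0 (k (inord 0)) * (2 * k (inord d) + 1) ^ e.+1)%N.
have NE k : k \in s -> N k = N k0.
  move=> ks; have := mahler_box_eq (etrans (sy _ ks) (esym (sy _ k0s))) (ltn0Sn _).
  by rewrite !subn0.
have N0 : (0 < N k0)%N by rewrite muln_gt0 box_coef_0 expn_gt0; lia.
(* Here [a_0 <= 4n] and [a_d <= 2n], so the product is at most [(4n)^d]. *)
apply: leq_trans (HB (N k0) _); last first.
  rewrite N0 /= expnS leq_mul // ?leq_exp2r //.
    by have := ltn_ord (k0 (inord 0)); rewrite box_coef_0; lia.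
  by have := ltn_ord (k0 (inord d)); lia.
rewrite -(size_map (fun k => 2 * k (inord d) + 1)%N); apply: uniq_leq_size.
  rewrite map_inj_in_uniq // => k k' ks ks' E.
  apply/ffunP => i; apply: val_inj; apply: (@box_coef_inj i).
  have := mahler_box_eq (etrans (sy _ ks) (esym (sy _ ks'))) (i := i).
  rewrite E inord_val => H.
  have [id|id] := ltnP i d.
    by apply/eqP; rewrite -(@eqn_pmul2r ((2 * k' (inord d) + 1) ^ (e.+1 - i))) ?H // expn_gt0; lia.
  have -> : i = inord d by apply: val_inj; rewrite /= inordK //; have := ltn_ord i; lia.
  by rewrite inordK // !box_coef_top.
move=> _ /mapP[k ks ->]; rewrite -dvdn_divisors // -(NE k ks) /N expnS.
by rewrite dvdn_mull // dvdn_mulr.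
Qed.

Lemma card_mahler_box B :
  (forall N, (0 < N <= (4 * n) ^ d)%N -> (size (divisors N) <= B)%N) ->
  (n ^ d.+1 <= 3 * B *
    size (undup [seq mahler R (box_poly k) | k <- enum (box_prim d n)]))%N.
Proof.
move=> HB; apply: leq_trans (card_box_prim n (isT : 1 < d)%N) _.
by rewrite -mulnA leq_mul2l /= cardE; apply: leq_count_fibers => y; exact: count_mahler_box.
Qed.

End Box.

(** * Comparison with the number of bounded polynomials *)

Section Northcott.
Variable R : realType.

Lemma int_minpoly_size (a : R[i]) d f :
  alg_degree a d -> int_minpoly a f -> size f = d.+1.
Proof.
move=> [p [ip [rp <-]]] [_ iF rf].
have rf' : root (map_poly ratr (map_poly intr f : {poly rat}) : {poly R[i]}) a.
  by rewrite -map_poly_comp (eq_map_poly (g := intr)) // => z /=; rewrite ratr_int.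
have p0 := irredp_neq0 ip; have f0 := irredp_neq0 iF.
have E : p %= map_poly intr f.
  by rewrite /eqp (irreducible_common_root ip f0 rp rf') (irreducible_common_root iF p0 rf' rp).
rewrite (eqp_size E) prednK ?lt0n ?size_poly_eq0 //.
by rewrite size_map_inj_poly //; exact: intr_inj.
Qed.

Lemma lead_coef_zcontents1 (f : {poly int}) : zcontents f = 1 -> 0 < lead_coef f.
Proof. by move=> z1; rewrite -sgz_gt0 -sgz_contents z1. Qed.

Lemma mahler_ge0 f : 0 <= lead_coef f -> 0 <= mahler R f.
Proof.
move=> lf; rewrite /mahler mulr_ge0 ?ler0z //; apply: prodr_ge0 => r _.
by rewrite le_max ler01.
Qed.

Lemma powR_invK (m : R) d : 0 <= m -> (0 < d)%N -> powR m d%:R^-1 ^+ d = m.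
Proof.
move=> m0 d0; rewrite -powR_mulrn ?powR_ge0 // -powRrM mulVf ?powRr1 //.
by rewrite pnatr_eq0 -lt0n.
Qed.

Lemma powR_inv_le (m X : R) d : 0 <= m -> 0 <= X -> (0 < d)%N ->
  (powR m d%:R^-1 <= X) = (m <= X ^+ d).
Proof.
move=> m0 X0 d0; rewrite -(@ler_pXn2r _ d) ?nnegrE ?powR_ge0 //.
by rewrite powR_invK.
Qed.

(** Shifting by [L] encodes the interval from [-L] to [L] as an ordinal type, so the candidates form
    a finite list of known length. *)
Definition small_polys d L : seq {poly int} :=
  [seq \poly_(i < d.+1) ((k (inord i) : nat)%:Z - L%:Z)
  | k : {ffun 'I_d.+1 -> 'I_(2 * L).+1}].

Lemma size_small_polys d L : size (small_polys d L) = ((2 * L).+1 ^ d.+1)%N.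
Proof. by rewrite size_map -cardT card_ffun !card_ord. Qed.

Lemma mem_small_polys d L (f : {poly int}) : (size f <= d.+1)%N ->
  (forall i, (absz (f`_i)%R <= L)%N) -> f \in small_polys d L.
Proof.
move=> sf H; have B i : (absz (f`_i + L%:Z)%R < (2 * L).+1)%N by have := H i; lia.
apply/mapP; exists [ffun i : 'I_d.+1 => Ordinal (B i)]; first by rewrite mem_enum.
apply/polyP => i; rewrite coef_poly; case: ltnP => [id|id].
  have P : 0 <= f`_i + L%:Z by have := H i; lia.
  by rewrite ffunE /= inordK // gez0_abs ?addrK.
by rewrite nth_default // (leq_trans sf).
Qed.

(** Height at most [X] means Mahler measure at most [X^d], hence coefficients at most [(2X)^d], of
    which [L] is an integral upper bound. Both lists are cut out of finite candidate lists by
    classical decision, and each polynomial supplies at most [d] roots. *)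
Lemma northcott d L (X : R) : (0 < d)%N -> 0 <= X ->
  (forall m : nat, m%:R <= (2 * X) ^+ d -> (m <= L)%N) ->
  exists (s : seq R[i]) (t : seq R),
      [/\ uniq s, uniq t,
          (forall a : R[i], a \in s <->
             (alg_degree a d /\ exists h, weil_height a h /\ h <= X)),
          (forall h : R, h \in t <->
             (exists a : R[i], alg_degree a d /\ weil_height a h /\ h <= X))
        & (size s <= d * (2 * L).+1 ^ d.+1)%N].
Proof.
move=> d0 X0 HL.
pose F := [seq f : {poly int} <- small_polys d L | size f == d.+1].
have memF (a : R[i]) f : alg_degree a d -> int_minpoly a f ->
    powR (mahler R f) ((size f).-1%:R)^-1 <= X -> f \in F.
  move=> da fa; have sf := int_minpoly_size da fa; rewrite sf /= => hX.
  have [/lead_coef_zcontents1 lf _ _] := fa.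
  rewrite powR_inv_le ?mahler_ge0 ?(ltW lf) // in hX.
  rewrite mem_filter sf eqxx mem_small_polys ?sf // => i.
  have := coef_le_mahler R i lf; rewrite -abszE -pmulrn => h.
  apply: HL; apply: le_trans h _.
  by rewrite sf /= exprMn ler_pM2l // exprn_gt0.
pose P a := alg_degree a d /\ exists h, weil_height a h /\ h <= X.
pose Q h := exists a : R[i], alg_degree a d /\ weil_height a h /\ h <= X.
exists (undup [seq a <- flatten [seq conjugates R f | f <- F] | `[< P a >]]).
exists (undup [seq h <- [seq powR (mahler R f) (d%:R)^-1 | f <- F] | `[< Q h >]]).
split; rewrite ?undup_uniq //.
- move=> a; rewrite mem_undup mem_filter; split=> [/andP[/asboolP]//|Pa].
  rewrite asboolT //=; have [da [h [[f [fa ->]] hX]]] := Pa.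
  apply/flattenP; exists (conjugates R f).
    by apply: map_f; exact: memF da fa hX.
  have [/lead_coef_zcontents1 lf _ rf] := fa.
  by rewrite -root_conjugates // -lead_coef_eq0 gt_eqF.
- move=> h; rewrite mem_undup mem_filter; split=> [/andP[/asboolP]//|Qh].
  rewrite asboolT //=; have [a [da [[f [fa hE]] hX]]] := Qh.
  apply/mapP; exists f; first by apply: memF da fa _; rewrite -hE.
  by rewrite hE (int_minpoly_size da fa).
- apply: leq_trans (size_undup _) _; rewrite size_filter.
  apply: leq_trans (count_size _ _) _.
  rewrite size_flatten /shape -map_comp sumnE big_map.
  apply: (@leq_trans (\sum_(f <- F) d)%N).
    rewrite big_seq [leqRHS]big_seq; apply: leq_sum => f; rewrite mem_filter => /andP[/eqP sf _].
    by rewrite -ltnS /= size_conjugates ?sf // -size_poly_eq0 sf.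
  rewrite big_const_seq count_predT iter_addn_0 leq_mul2l -size_small_polys.
  by rewrite size_filter count_size orbT.
Qed.

(** The [d]-th root is injective on nonnegative reals, so distinct measures give distinct heights;
    primitive box polynomials are minimal polynomials, and the bound on [n] keeps their heights
    below [X]. *)
Lemma mahler_box_heights e n (X : R) (t : seq R) : 0 <= X ->
  (4 * e.+3 * n)%N%:R <= X ^+ e.+2 ->
  (forall h : R, (exists a : R[i], alg_degree a e.+2 /\ weil_height a h /\ h <= X) -> h \in t) ->
  (size (undup [seq mahler R (box_poly k) | k <- enum (box_prim e.+2 n)]) <= size t)%N.
Proof.
move=> X0 nX Ht; set u := undup _.
have mu m : m \in u -> exists2 k, k \in box_prim e.+2 n & m = mahler R (box_poly k).
  by rewrite mem_undup => /mapP[k]; rewrite mem_enum => kp ->; exists k.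
have m0 (k : box e.+2 n) : 0 <= mahler R (box_poly k).
  by rewrite mahler_ge0 // lead_coef_box_poly.
apply: (@leq_trans (size [seq powR m e.+2%:R^-1 | m <- u])).
  by rewrite size_map.
apply: uniq_leq_size.
  rewrite map_inj_in_uniq ?undup_uniq // => _ _ /mu[k _ ->] /mu[k' _ ->] E.
  by rewrite -[LHS](powR_invK (m0 k) (ltn0Sn e.+1)) E (powR_invK (m0 k')).
move=> _ /mapP[_ /mu[k kp ->] ->]; apply: Ht.
have [x [_ rx _ mx]] := mahler_box R k.
have rxC : root (map_poly intr (box_poly k) : {poly R[i]}) x%:C%C.
  by rewrite map_intr_toC fmorph_root.
exists x%:C%C; split; last split.
- exists (map_poly intr (box_poly k)); split; first exact: irreducible_box_poly.
  split; last by rewrite size_map_inj_poly ?size_box_poly //; exact: intr_inj.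
  by rewrite -map_poly_comp (eq_map_poly (g := intr)) // => z /=; rewrite ratr_int.
- exists (box_poly k); split; last by rewrite size_box_poly.
  by split => //; [exact: zcontents_box_poly | exact: irreducible_box_poly].
- by rewrite powR_inv_le // (le_trans mx).
Qed.

End Northcott.

(** * Choice of constants and conclusion *)

Theorem theorem4p3 (R : realType) (d : nat) : (2 <= d)%N ->
  forall eps : R, 0 < eps ->
  exists H0 : R, forall X : R, H0 <= X ->
    exists (s : seq R[i]) (t : seq R),
      [/\ uniq s, uniq t,
          (forall a : R[i], a \in s <->
             (alg_degree a d /\ exists h, weil_height a h /\ h <= X)),
          (forall h : R, h \in t <->
             (exists a : R[i], alg_degree a d /\ weil_height a h /\ h <= X))
        & (size s)%:R <= powR X eps * (size t)%:R].
Proof.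
case: d => [|[|e]] // _ eps eps0; set d := e.+2.
(* With [d^2 + 1 <= eps * k], taking [k]-th powers reduces the final estimate to the integral
   exponent [d^2 + 1]. *)
pose k := (Num.truncn ((d ^ 2 + 1)%:R / eps)).+1.
have kP : (d ^ 2 + 1)%N%:R <= eps * k%:R.
  by rewrite mulrC -ler_pdivrMr // ltW // truncnS_gt.
(* [A] comes from [2L + 1 <= 3 * 2^d * X^d] and [X^d <= 4(d+1)(n+1) <= 8(d+1)n], so that
   [size s <= A * n^(d+1)]. *)
pose A := (d * (3 * 2 ^ d * (8 * d.+1)) ^ d.+1)%N.
(* [D] collects the constants in the [k]-th power of [3 * A * B]; the threshold lets one factor [X]
   absorb it, and [X >= 4(d+1)] ensures [n >= 1]. *)
pose D := ((3 * A) ^ k * (k ^ k) ^ (2 ^ k))%N.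
exists (D + 4 * d.+1)%N%:R => X HX.
have XD : D%:R <= X by apply: le_trans HX; rewrite ler_nat leq_addr.
have X4 : (4 * d.+1)%N%:R <= X by apply: le_trans HX; rewrite ler_nat leq_addl.
have X1 : 1 <= X by apply: le_trans X4; rewrite -[1]/(1%:R) ler_nat.
have X0 : 0 <= X by apply: le_trans X1.
set T := X ^+ d.
have XT : X <= T by rewrite -[leLHS]expr1 ler_weXn2l.
have T0 : 0 <= T by apply: le_trans XT.
pose L := Num.truncn ((2 * X) ^+ d).
have LP : L%:R <= (2 * X) ^+ d by rewrite truncn_le // exprn_ge0 // mulr_ge0.
(* The largest box whose Mahler measures are guaranteed to stay below [X^d] by [mahler_box]. *)
pose n := Num.truncn (T / (4 * d.+1)%N%:R).
have c0 : 0 < (4 * d.+1)%N%:R :> R by rewrite ltr0n.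
have nT : (4 * d.+1 * n)%N%:R <= T.
  rewrite natrM mulrC -ler_pdivlMr // truncn_le // divr_ge0 // ltW.
have Tn : T <= (4 * d.+1 * n.+1)%N%:R.
  by rewrite [leRHS]natrM mulrC -ler_pdivrMr // ltW // truncnS_gt.
have n0 : (0 < n)%N.
  rewrite truncn_gt0 ler_pdivlMr // mul1r; exact: le_trans XT.
have [|s [t [us ut sP tP ss]]] := @northcott R d L X isT X0.
  by move=> m hm; rewrite truncn_ge_nat // exprn_ge0 // mulr_ge0.
exists s, t; split => //.
have [B BP HB] := @size_divisors_uniform k ((4 * n) ^ d) isT.
have c3 : 0 <= 3%:R * 2%:R ^+ d :> R by rewrite mulr_ge0 ?ler0n // exprn_ge0 ?ler0n.
have st : (size s <= 3 * A * B * size t)%N.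
  have ut' := mahler_box_heights X0 nT (fun h => (tP h).2).
  have := card_mahler_box R HB => nB.
  apply: leq_trans ss _.
  apply: (@leq_trans (A * n ^ d.+1)).
    rewrite /A -mulnA leq_mul2l /= -expnMn leq_exp2r //.
    rewrite -(ler_nat R) -addn1 natrD natrM.
    apply: (@le_trans _ _ (3 * 2 ^+ d * T)).
      have : 1 <= (2 * X) ^+ d by rewrite exprn_ege1 //; lra.
      by rewrite -mulrA -exprMn; lra.
    rewrite -mulnA natrM [(3 * 2 ^ d)%N%:R]natrM natrX ler_wpM2l ?c3 //.
    apply: (le_trans Tn); rewrite ler_nat -[8%N]/(4 * 2)%N -!mulnA leq_mul2l /=.
    by rewrite mulnCA leq_mul2l /= mul2n -addnn -addn1 leq_add2l n0.
  have -> : (3 * A * B * size t = A * (3 * B * size t))%N by rewrite [(3 * A)%N]mulnC !mulnA.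
  by rewrite leq_mul2l (leq_trans nB) ?orbT // leq_mul2l ut' orbT.
(* In [k]-th powers: [(3AB)^k <= D (4n)^d <= X * (X^d)^d], using [4n <= X^d]. *)
have Bk : (3 * A * B)%N%:R <= powR X eps.
  rewrite -(@ler_pXn2r _ k) ?nnegrE ?powR_ge0 //.
  rewrite -[leRHS]powR_mulrn ?powR_ge0 // -powRrM.
  apply: (@le_trans _ _ (powR X (d ^ 2 + 1)%N%:R)); last by rewrite ler_powR.
  rewrite powR_mulrn // exprD expr1 mulrC -natrX expnMn.
  apply: (@le_trans _ _ (D * (4 * n) ^ d)%N%:R).
    by rewrite ler_nat /D -mulnA leq_mul2l BP orbT.
  rewrite natrM ler_pM // ?exprn_ge0 // natrX -mulnn exprM.
  rewrite lerXn2r ?nnegrE ?exprn_ge0 //.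
  by apply: le_trans nT; rewrite ler_nat -mulnA leq_mul2l /= leq_pmull.
apply: (@le_trans _ _ (3 * A * B * size t)%N%:R); first by rewrite ler_nat.
by rewrite natrM ler_wpM2r.
Qed.
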